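(* Let $\mathbf{k}$ be a multi-index with $\operatorname{wt}(\mathbf{k})=-1$. Then $$W_{\mathbf{k}}=\sum_{a\in A}\ \sum_{\substack{j\ge -1\\ k_j^a\ge 1}}\frac{1}{(j+1)!}\sum_{\substack{\mathbf{k}^{1}+\cdots+\mathbf{k}^{j+1}=\mathbf{k}-\mathbf{e}_j^a\\ \operatorname{wt}(\mathbf{k}^{m})=-1\ \text{for all } 1\le m\le j+1}}W_{\mathbf{k}^{1}}\cdots W_{\mathbf{k}^{j+1}},$$ where the inner sum is over ordered $(j+1)$-tuples of multi-indices.
   Context: $A$ is a finite set (of decorations) and $I_A:=A\times\mathbb{Z}_{\ge -1}$. A multi-index is a finitely supported map $\mathbf{k}:I_A\to\mathbb{Z}_{\ge 0}$, written $k_j^a:=\mathbf{k}(a,j)$; set $|\mathbf{k}|=\sum_{a,j}k_j^a$ and $\operatorname{wt}(\mathbf{k})=\sum_{a,j}j\,k_j^a$ (sums over $a\in A$, $j\ge -1$). $\mathbf{e}_j^a$ is the multi-index with $(a,j)$-coordinate $1$ and all other coordinates $0$; sums and differences are componentwise. An $A$-decorated rooted tree is a finite rooted tree $t$ with a map $d:V(t)\to A$; isomorphisms preserve the root and the decorations. The fertility $f(v)$ of a vertex $v$ is its number of children. The profile of $t$ is the multi-index $\mathbf{k}(t)$ with $k_j^a(t)=\#\{v\in V(t): d(v)=a,\ f(v)=j+1\}$. Let $\mathcal{F}_{\mathbf{k}}$ be the (finite) set of isomorphism classes of $A$-decorated rooted trees with profile $\mathbf{k}$; put $\sigma(t):=|\operatorname{Aut}(t)|$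 and $$W_{\mathbf{k}}:=\sum_{t\in\mathcal{F}_{\mathbf{k}}}\frac{1}{\sigma(t)}.$$ For $j=-1$ the inner sum is over the empty tuple: it equals $1$ if $\mathbf{k}=\mathbf{e}_{-1}^a$ and $0$ otherwise. *)

(* Defs.v *)
From HB Require Import structures.
From mathcomp Require Import all_boot all_order all_fingroup all_algebra.
From mathcomp Require Import finmap multiset.
From mathcomp Require Import boolp classical_sets functions cardinality fsbigop.
Set Implicit Arguments.
Unset Strict Implicit.
Unset Printing Implicit Defensive.
Import Order.TTheory GRing.Theory Num.Theory.
Local Open Scope ring_scope.

(* The integers j >= -1.  [arity j] is the natural number j + 1, and
   [arity_index n] is the integer n - 1. *)
Definition geN1 := {j : int | -1 <= j}.

Definition arity (j : geN1) : nat := `|(val j + 1)%R|%N.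

Lemma arity_index_subproof (n : nat) : -1 <= n%:Z - 1.
Proof. by rewrite lerDr. Qed.

Definition arity_index (n : nat) : geN1 := 
  exist (fun j : int => is_true (-1 <= j)) _ (arity_index_subproof n).

Lemma arityE (j : geN1) : (arity j)%:Z = val j + 1.
Proof. by rewrite /arity gez0_abs // -lerBlDr sub0r; exact: (valP j). Qed.

Lemma arity_indexK : cancel arity_index arity.
Proof. by move=> n; rewrite /arity /= subrK. Qed.

Lemma arityK : cancel arity arity_index.
Proof. by move=> j; apply: val_inj; rewrite /= arityE addrK. Qed.

(* {mset K} is {fsfun K -> nat with 0}: the finitely supported maps K -> nat. *)
Definition mindex (A : finType) := {mset (A * geN1)%type}%mset.

Definition msize (A : finType) (k : mindex A) : nat :=
  (\sum_(p <- finsupp k) k p)%N.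

Definition wt (A : finType) (k : mindex A) : int :=
  \sum_(p <- finsupp k) val p.2 * (k p)%:Z.

(* An A-decorated rooted tree on the vertex set V is given by its root, the map
   sending each vertex to its parent, and its decoration.  The parent of the
   root is by convention the root itself; every vertex must reach the root by
   iterating the parent map (which rules out cycles). *)
Definition dtree_axiom (A V : finType)
    (x : V * {ffun V -> V} * {ffun V -> A}) : bool :=
  (x.1.2 x.1.1 == x.1.1) && [forall v, fconnect x.1.2 v x.1.1].

Record dtree (A V : finType) := DTree {
  dtree_val :> V * {ffun V -> V} * {ffun V -> A};
  _ : dtree_axiom dtree_val }.

HB.instance Definition _ (A V : finType) := [isSub for @dtree_val A V].
HB.instance Definition _ (A V : finType) := [Finite of dtree A V by <:].

Section Trees.
Variable A : finType.

Definition troot (V : finType) (t : dtree A V) : V := t.1.1.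
Definition parent (V : finType) (t : dtree A V) : V -> V := t.1.2.
Definition deco (V : finType) (t : dtree A V) : V -> A := t.2.

Definition children (V : finType) (t : dtree A V) (v : V) : {set V} :=
  [set u | (u != troot t) && (parent t u == v)]%SET.

Definition fertility (V : finType) (t : dtree A V) (v : V) : nat :=
  #|children t v|.

Definition profile (V : finType) (t : dtree A V) : mindex A :=
  seq_mset [seq (deco t v, arity_index (fertility t v)) | v <- enum V].

Lemma profileE (V : finType) (t : dtree A V) (a : A) (j : geN1) :
  profile t (a, j) =
  #|[set v | (deco t v == a) && ((fertility t v)%:Z == val j + 1)]%SET|.
Proof.
rewrite mset_seqE count_map cardE -size_filter /enum_mem -filter_predI.
congr size; apply: eq_filter => v /=; rewrite !inE andbT xpair_eqE.
congr (_ && _).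
by rewrite -val_eqE /= subr_eq.
Qed.

(* An isomorphism is a bijection h that satisfies [tree_morph]. *)
Definition tree_morph (V V' : finType) (t : dtree A V) (u : dtree A V')
    (h : V -> V') : bool :=
  [&& h (troot t) == troot u,
      [forall v, h (parent t v) == parent u (h v)] &
      [forall v, deco u (h v) == deco t v]].

Definition isomorphic (V : finType) : rel (dtree A V) :=
  fun t u => [exists h : {perm V}, tree_morph t u h].

Definition automorphisms (V : finType) (t : dtree A V) : {set {perm V}} :=
  [set h : {perm V} | tree_morph t t h]%SET.

Definition sigma (V : finType) (t : dtree A V) : nat := #|automorphisms t|.

(* A tree with profile k has msize k vertices (card_profile below), so every
   such tree is isomorphic to one with vertex set 'I_(msize k)
   (exists_labelled below). *)
Definition labelled (k : mindex A) : {set dtree A 'I_(msize k)} :=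
  [set t | profile t == k]%SET.

(* One representative of each isomorphism class of trees with profile k. *)
Definition tree_reps (k : mindex A) : {set dtree A 'I_(msize k)} :=
  transversal (equivalence_partition (@isomorphic _) (labelled k)) (labelled k).

Definition W (k : mindex A) : rat :=
  \sum_(t in tree_reps k) (sigma t)%:R^-1.

Lemma msizeE (k : mindex A) : msize k = size (enum_mset k).
Proof.
rewrite -sum1_size (sum_mset k xpredT) /msize.
by apply: eq_bigr => i _; rewrite muln1.
Qed.

Lemma card_profile (V : finType) (t : dtree A V) : msize (profile t) = #|V|.
Proof. by rewrite msizeE (perm_size (perm_eq_seq_mset _)) size_map -cardE. Qed.

Lemma isomorphic_equiv (V : finType) : equivalence_rel (@isomorphic V).
Proof.
have refl : reflexive (@isomorphic V).
  move=> t; apply/existsP; exists 1%g; rewrite /tree_morph perm1 eqxx /=.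
  by apply/andP; split; apply/forallP => v; rewrite !perm1.
have symm t u : isomorphic t u -> isomorphic u t.
  case/existsP=> h /and3P[/eqP hr /forallP hp /forallP hd].
  apply/existsP; exists h^-1%g; apply/and3P; split.
  - by rewrite -hr permK.
  - apply/forallP => v; rewrite (canF_eq (permK h^-1)) invgK.
    by rewrite (eqP (hp _)) permKV.
  - by apply/forallP => v; rewrite -{2}(permKV h v) eq_sym; apply: hd.
have trans t u w : isomorphic t u -> isomorphic u w -> isomorphic t w.
  case/existsP=> h /and3P[/eqP hr /forallP hp /forallP hd].
  case/existsP=> g /and3P[/eqP gr /forallP gp /forallP gd].
  apply/existsP; exists (h * g)%g; apply/and3P; split.
  - by rewrite permM hr gr.
  - by apply/forallP => v; rewrite !permM (eqP (hp _)) (eqP (gp _)).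
  - by apply/forallP => v; rewrite permM (eqP (gd _)) (eqP (hd _)).
move=> t u w; split=> [|tu]; first exact: refl.
by apply/idP/idP; apply: trans => //; apply: symm.
Qed.

Lemma profile_iso (V V' : finType) (t : dtree A V) (u : dtree A V')
  (h : V -> V') : bijective h -> tree_morph t u h -> profile u = profile t.
Proof.
move=> bij_h /and3P[/eqP hr /forallP hp /forallP hd].
have inj_h := bij_inj bij_h.
have fert v : fertility u (h v) = fertility t v.
  rewrite /fertility -(card_imset (children t v) inj_h); congr #|pred_of_set _|.
  apply/setP => w; case: bij_h => h' hK h'K.
  rewrite -(h'K w) (mem_imset _ _ inj_h) !inE -hr (inj_eq inj_h).
  by rewrite -(eqP (hp _)) (inj_eq inj_h).
have perm_h : perm_eq (enum V') [seq h v | v <- enum V].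
  apply: uniq_perm; rewrite ?enum_uniq ?(map_inj_uniq inj_h) ?enum_uniq //.
  move=> w; case: bij_h => h' _ h'K; rewrite mem_enum -[w]h'K.
  by rewrite mem_map // mem_enum.
rewrite /profile; apply/eq_seq_msetP.
rewrite (perm_trans (perm_map _ perm_h)) // -map_comp.
rewrite (eq_map (g := fun v => (deco t v, arity_index (fertility t v)))) //.
by move=> v /=; rewrite fert (eqP (hd v)).
Qed.

Lemma exists_labelled (V : finType) (t : dtree A V) (k : mindex A) :
  profile t = k ->
  exists2 u : dtree A 'I_(msize k), u \in labelled k &
    exists2 h : V -> 'I_(msize k), bijective h & tree_morph t u h.
Proof.
move=> tk; have cardV : #|V| = msize k by rewrite -tk card_profile.
pose h v : 'I_(msize k) := cast_ord cardV (enum_rank v).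
pose h' i : V := enum_val (cast_ord (esym cardV) i).
have hK : cancel h h' by move=> v; rewrite /h /h' cast_ordK enum_rankK.
have h'K : cancel h' h by move=> i; rewrite /h /h' enum_valK cast_ordKV.
pose x := (h (troot t), [ffun i => h (parent t (h' i))],
           [ffun i => deco t (h' i)]).
have xP : dtree_axiom x.
  have /andP[tr /forallP tc] := valP t.
  have {tr} tr : parent t (troot t) = troot t by apply/eqP.
  rewrite /dtree_axiom /x /= ffunE hK tr eqxx /=.
  apply/forallP => i; have /iter_findex := tc (h' i).
  move: (findex _ _ _) => n itn.
  have iterh m : iter m [ffun i => h (parent t (h' i))] i =
                 h (iter m (parent t) (h' i)).
    by elim: m => [|m IH] /=; rewrite ?h'K // IH ffunE hK.
  by rewrite -[X in h X]itn -iterh; exact: fconnect_iter.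
have morph : tree_morph t (DTree xP) h.
  apply/and3P; split; first by [].
  - by apply/forallP => v; rewrite /parent /= ffunE hK.
  - by apply/forallP => v; rewrite /deco /= ffunE hK.
have bij_h : bijective h by exists h'.
exists (DTree xP); last by exists h.
by rewrite inE (profile_iso bij_h morph) tk.
Qed.
End Trees.

Definition decompositions (A : finType) (k : mindex A) (n : nat) :
    set {ffun 'I_n -> mindex A} :=
  [set ks | (\big[msetD/mset0]_(m < n) ks m = k)%mset /\
            forall m, wt (ks m) = -1]%classic.
Arguments decompositions {A} k n.

(* Hence the sums \sum_(ks \in decompositions k n) are genuine finite sums. *)
Lemma finite_decompositions (A : finType) (k : mindex A) (n : nat) :
  finite_set (decompositions k n).
Proof.
pose T := {ffun 'I_n -> {ffun finsupp k -> 'I_(msize k).+1}}.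
pose F (g : T) : {ffun 'I_n -> mindex A} :=
  [ffun m => [fsfun p => (g m p : nat)]].
apply: (@sub_finite_set _ _ (F @` [set: T])%classic); last first.
  exact/finite_image/finite_finset.
move=> ks [sumks _].
have sumE p : k p = (\sum_(m < n) ks m p)%N.
  rewrite -sumks (big_morph (fun K : mindex A => K p) (op1 := addn) (id1 := 0%N)) //.
    by move=> K L; rewrite msetE2.
  by rewrite mset0E.
have le_ks m p : (ks m p <= k p)%N by rewrite sumE (bigD1 m) //= leq_addr.
have le_k p : (k p <= msize k)%N.
  have [pk|/fsfun_dflt -> //] := boolP (p \in finsupp k).
  by rewrite /msize (big_fsetD1 p) //= leq_addr.
exists [ffun m => [ffun p => inord (ks m (val p))]] => //.
apply/ffunP => m; rewrite ffunE; apply/fsfunP => p.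
rewrite fsfun_ffun; case: insubP => [q _ <-|pk].
  by rewrite /= !ffunE; apply: inordK; rewrite ltnS (leq_trans (le_ks _ _)).
by apply/esym/eqP; rewrite -leqn0 (leq_trans (le_ks _ _)) ?fsfun_dflt.
Qed.

(* Main.v *)
(* With n = |k|, orbit-stabilizer for the relabelling action of the symmetric
   group gives W_k = L_k / n!, where L_k counts the trees on {1..n} with profile
   k.  Cutting the edge above a child c of the root of a tree on V puts the pairs
   (t, c) in bijection with the triples (S, t', t'') where S is a subset of V (the
   descendants of c), t'' is a tree on S and t' a tree on the complement of S
   whose root has one child less.  Counting the subsets S by binomial
   coefficients yields a recursion on the fertility of the root, whose solution is
   the sum over ordered decompositions divided by (j+1)!. *)
Require Import Defs.
From mathcomp Require Import all_boot all_order all_fingroup all_algebra.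
From mathcomp Require Import finmap multiset zify ring.
From mathcomp Require Import boolp classical_sets functions cardinality fsbigop.
Set Implicit Arguments.
Unset Strict Implicit.
Unset Printing Implicit Defensive.
Import Order.TTheory GRing.Theory Num.Theory.
Local Open Scope ring_scope.

Section Trees.
Variable A : finType.

(** * Constructing and comparing trees *)

Lemma dtree_eq (V : finType) (t u : dtree A V) :
  troot t = troot u -> parent t =1 parent u -> deco t =1 deco u -> t = u.
Proof.
case: t u => [[[r p] d] tP] [[[r' p'] d'] uP] rr' pp' dd'; apply: val_inj.
by congr (_, _, _); [exact: rr' | exact/ffunP | exact/ffunP].
Qed.

Lemma parent_root (V : finType) (t : dtree A V) : parent t (troot t) = troot t.
Proof. by case/andP: (valP t) => /eqP. Qed.

Lemma fconnect_root (V : finType) (t : dtree A V) v :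
  fconnect (parent t) v (troot t).
Proof. by case/andP: (valP t) => _ /forallP/(_ v). Qed.

Section Mk.
Variables (V : finType) (r : V) (p : V -> V) (d : V -> A).
Hypotheses (pr : p r = r) (pP : forall v, fconnect p v r).

Lemma mk_dtree_axiom : dtree_axiom (r, [ffun v => p v], [ffun v => d v]).
Proof.
rewrite /dtree_axiom /= ffunE pr eqxx; apply/forallP => v.
by rewrite (eq_fconnect (ffunE p)).
Qed.

Definition mk_dtree : dtree A V := DTree mk_dtree_axiom.

Lemma mk_root : troot mk_dtree = r. Proof. by []. Qed.
Lemma mk_parent : parent mk_dtree =1 p. Proof. exact: ffunE. Qed.
Lemma mk_deco : deco mk_dtree =1 d. Proof. exact: ffunE. Qed.
End Mk.

(** A path to [r] may be stopped at its first visit to [r], so the two maps need to agree only away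
    from [r]. This freedom matters for grafting, which changes the parent of a former root. *)
Lemma fconnect_transfer (T T' : finType) (f : T -> T') (p : T -> T)
    (q : T' -> T') (r : T) :
  injective f -> (forall x, x != r -> q (f x) = f (p x)) ->
  forall x, fconnect q (f x) (f r) = fconnect p x r.
Proof.
move=> f_inj qf x; apply/idP/idP => /iter_findex; move: (findex _ _ _) => n.
  elim: n x => [|n IHn] x; first by move=> /f_inj ->; exact: connect0.
  rewrite iterSr; have [-> _|xr] := eqVneq x r; first exact: connect0.
  by rewrite qf // => /IHn; apply: connect_trans; exact: fconnect1.
elim: n x => [|n IHn] x; first by move=> /= ->; exact: connect0.
rewrite iterSr; have [-> _|xr] := eqVneq x r; first exact: connect0.
by move/IHn; apply: connect_trans; rewrite -qf //; exact: fconnect1.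
Qed.

(** * Relabelling *)

Section Relabel.
Variables (V V' : finType) (h : V -> V') (g : V' -> V).
Hypotheses (hK : cancel h g) (gK : cancel g h).

Lemma relabel_root (t : dtree A V) :
  h (parent t (g (h (troot t)))) = h (troot t).
Proof. by rewrite hK parent_root. Qed.

Lemma relabel_connect (t : dtree A V) v' :
  fconnect (fun v' => h (parent t (g v'))) v' (h (troot t)).
Proof.
rewrite -{1}(gK v') (@fconnect_transfer _ _ h (parent t)) ?fconnect_root //.
  exact: can_inj hK.
by move=> x _; rewrite hK.
Qed.

Definition relabel (t : dtree A V) : dtree A V' :=
  mk_dtree (fun v' => deco t (g v')) (relabel_root t) (relabel_connect t).

Lemma relabel_morph t : tree_morph t (relabel t) h.
Proof.
apply/and3P; split; first by [].
  by apply/forallP => v; rewrite mk_parent hK.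
by apply/forallP => v; rewrite mk_deco hK.
Qed.

(** Transport of structure: a bijection and its source tree determine the target tree. Isomorphism
    thereby becomes an equation, and isomorphism classes become orbits. *)
Lemma tree_morph_relabel t u : tree_morph t u h -> u = relabel t.
Proof.
case/and3P => /eqP hr /forallP hp /forallP hd; apply: dtree_eq => [//|v|v].
  by rewrite mk_parent -{1}(gK v) -(eqP (hp _)).
by rewrite mk_deco -{1}(gK v) (eqP (hd _)).
Qed.

Lemma profile_relabel t : profile (relabel t) = profile t.
Proof. by apply: (profile_iso _ (relabel_morph t)); exists g. Qed.

Lemma children_relabel t v : children (relabel t) (h v) = h @: children t v.
Proof.
apply/setP => w; rewrite -(gK w) mem_imset ?inE; last exact: can_inj hK.
by rewrite mk_parent hK !(can_eq hK).
Qed.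

Lemma fertility_relabel t v : fertility (relabel t) (h v) = fertility t v.
Proof.
by rewrite /fertility children_relabel card_imset //; exact: can_inj hK.
Qed.
End Relabel.

Lemma relabelK (V V' : finType) (h : V -> V') (g : V' -> V)
  (hK : cancel h g) (gK : cancel g h) :
  cancel (relabel hK gK) (@relabel _ _ g h gK hK).
Proof.
move=> t; apply: dtree_eq => [|v|v]; first by rewrite !mk_root hK.
  by rewrite !mk_parent !hK.
by rewrite !mk_deco !hK.
Qed.

(** * Labelled trees and the action of the symmetric group *)

Section LabelledCount.
Variable n : nat.

Definition act_perm (t : dtree A 'I_n) (h : 'S_n) : dtree A 'I_n :=
  relabel (permK h) (permKV h) t.

Lemma act_perm_morph (t u : dtree A 'I_n) (h : 'S_n) :
  tree_morph t u h = (act_perm t h == u).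
Proof.
apply/idP/eqP => [|<-]; last exact: relabel_morph.
by move/(tree_morph_relabel (permK h) (permKV h)) ->.
Qed.

Lemma act_perm1 : act_perm^~ 1%g =1 id.
Proof.
move=> t; apply/eqP; rewrite -act_perm_morph /tree_morph perm1 eqxx /=.
by apply/andP; split; apply/forallP => v; rewrite !perm1.
Qed.

Lemma act_permM t : act_morph act_perm t.
Proof.
move=> g h; apply: dtree_eq => [|v|v]; first by rewrite !mk_root permM.
  by rewrite !mk_parent invMg !permM.
by rewrite !mk_deco invMg !permM.
Qed.

Definition relabel_action := TotalAction act_perm1 act_permM.

(** Orbit-stabilizer: the isomorphism class of [t] is its orbit under relabelling, and its
    automorphisms form the stabilizer. *)
Lemma card_isomorphic (t : dtree A 'I_n) :
  (#|[set u | isomorphic t u]| * sigma t)%N = n`!.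
Proof.
rewrite -card_Sn -cardsT.
rewrite -(card_orbit_stab relabel_action [set: 'S_n]%G t) /=.
congr (_ * _)%N; apply: eq_card => u; rewrite !inE.
  apply/existsP/orbitP => -[h]; rewrite ?act_perm_morph.
    by move/eqP; exists h; rewrite ?inE.
  by move=> _ hu; exists h; rewrite act_perm_morph; exact/eqP.
by rewrite finset.sub1set inE act_perm_morph.
Qed.
End LabelledCount.

Definition ntrees (V : finType) (k : mindex A) : nat :=
  #|[set t : dtree A V | profile t == k]|.

(** The labelled trees split into isomorphism classes of size [n! / sigma t], where [n = msize k];
    after division by [n!], each representative contributes [1 / sigma t]. *)
Lemma W_ntrees (k : mindex A) :
  W k = (ntrees 'I_(msize k) k)%:R / (msize k)`!%:R.
Proof.
set L := labelled k; set P := equivalence_partition (@isomorphic _ _) L.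
have equivL : {in L & &, equivalence_rel (@isomorphic A 'I_(msize k))}.
  by move=> t u w _ _ _; exact: isomorphic_equiv.
have partP : finset.partition P L := equivalence_partitionP equivL.
have trP := transversalP partP.
have subL := transversal_sub trP.
rewrite /ntrees -/L (card_partition partP) -(pblock_transversal trP).
rewrite big_imset; last exact: pblock_inj trP.
rewrite natr_sum mulr_suml; apply: eq_bigr => t /(fintype.subsetP subL) tL.
(* The block of [t] is its whole isomorphism class, since isomorphic trees have the same profile and
   so remain in [L]. *)
have -> : finset.pblock P t = [set u | isomorphic t u].
  apply/setP => u; rewrite inE; apply/idP/idP => [ut|tu].
    have uL : u \in L.
      apply: fintype.subsetP u ut; apply: (partitionS partP).
      by rewrite pblock_mem // (cover_partition partP).
    by rewrite -(pblock_equivalence_partition equivL) // -/P.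
  have uL : u \in L.
    move: tL; rewrite !inE; case/existsP: tu => h tu.
    have bij_h : bijective h by exists (h^-1)%g; [exact: permK | exact: permKV].
    by rewrite (profile_iso bij_h tu).
  by rewrite (pblock_equivalence_partition equivL).
rewrite -(card_isomorphic t) natrM invfM mulVKf // pnatr_eq0 -lt0n.
by rewrite card_gt0; apply/finset.set0Pn; exists t; rewrite inE (isomorphic_equiv t t t).
Qed.

(** * Grafting and cutting *)

Definition descendants (V : finType) (t : dtree A V) (c : V) : {set V} :=
  [set v | fconnect (parent t) v c].

Definition node (V : finType) (t : dtree A V) (v : V) : A * geN1 :=
  (deco t v, arity_index (fertility t v)).

(** Profiles, and fertilities below, are written as sums over all vertices so that they split along
    a disjoint union of vertex sets. *)
Lemma profile_sum (V : finType) (t : dtree A V) (p : A * geN1) :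
  profile t p = (\sum_v (node t v == p))%N.
Proof.
rewrite mset_seqE count_map -sum1_count big_enum_cond /= big_mkcond /=.
by apply: eq_bigr => v _; rewrite /= -/(node t v); case: eqP.
Qed.

Lemma fertility_sum (V : finType) (t : dtree A V) (v : V) :
  fertility t v = (\sum_u ((u != troot t) && (parent t u == v)))%N.
Proof.
by rewrite /fertility -sum1dep_card big_mkcond /=; apply: eq_bigr => u _; case: ifP.
Qed.

Section Graft.
Variables (V1 V2 : finType).
Implicit Types (t : dtree A V1) (u : dtree A V2).

Definition graft_parent t u (x : V1 + V2) : V1 + V2 :=
  match x with
  | inl v => inl (parent t v)
  | inr v => if v == troot u then inl (troot t) else inr (parent u v)
  end.

Definition graft_deco t u (x : V1 + V2) : A :=
  match x with inl v => deco t v | inr v => deco u v end.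

Lemma graft_parent_root t u :
  graft_parent t u (inl (troot t)) = inl (troot t).
Proof. by rewrite /= parent_root. Qed.

Lemma graft_connect_inl t u v w :
  fconnect (graft_parent t u) (inl v) (inl w) = fconnect (parent t) v w.
Proof. by apply: fconnect_transfer => // x y []. Qed.

Lemma graft_connect_inr t u v :
  fconnect (graft_parent t u) (inr v) (inr (troot u)).
Proof.
rewrite (@fconnect_transfer _ _ inr (parent u)) ?fconnect_root //.
  by move=> x y [].
by move=> x /negPf /= ->.
Qed.

(** The parent map never leaves the left summand. *)
Lemma graft_connect_inlr t u v w :
  fconnect (graft_parent t u) (inl v) (inr w) = false.
Proof.
apply/negP => /iter_findex; move: (findex _ _ _) => n.
suff -> : iter n (graft_parent t u) (inl v) = inl (iter n (parent t) v) by [].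
by elim: n => //= n ->.
Qed.

Lemma graft_connect t u x :
  fconnect (graft_parent t u) x (inl (troot t)).
Proof.
case: x => v; first by rewrite graft_connect_inl fconnect_root.
apply: connect_trans (graft_connect_inr t u v) _.
by apply: connect1; rewrite /= eqxx.
Qed.

Definition graft t u : dtree A (V1 + V2)%type :=
  mk_dtree (graft_deco t u) (graft_parent_root t u) (graft_connect t u).

Definition right_part : {set V1 + V2} :=
  [set x | if x is inr _ then true else false].

Lemma graft_descendants t u :
  descendants (graft t u) (inr (troot u)) = right_part.
Proof.
apply/setP => x; rewrite !inE (eq_fconnect (mk_parent _ _ _)).
by case: x => v; rewrite ?graft_connect_inr ?graft_connect_inlr.
Qed.

Lemma graft_child t u :
  inr (troot u) \in children (graft t u) (troot (graft t u)).
Proof. by rewrite inE mk_parent /= eqxx. Qed.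

Lemma fertility_graft_inl t u v :
  fertility (graft t u) (inl v) = (fertility t v + (v == troot t))%N.
Proof.
rewrite !fertility_sum big_sumType; congr (_ + _)%N.
  by apply: eq_bigr => x _; rewrite mk_parent.
rewrite (bigD1 (troot u)) //= mk_parent /= eqxx big1 ?addn0.
  by rewrite eq_sym.
by move=> x /negPf xr; rewrite mk_parent /= xr.
Qed.

Lemma fertility_graft_inr t u v :
  fertility (graft t u) (inr v) = fertility u v.
Proof.
rewrite !fertility_sum big_sumType big1 ?add0n.
  apply: eq_bigr => x _; rewrite mk_parent /=; case: (x == troot u) => //=.
by move=> x _; rewrite mk_parent /= andbF.
Qed.

(* Grafting changes the fertility of the root of [t] and of no other vertex. *)
Lemma profile_graft t u :
  (node t (troot t) +` profile (graft t u) =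
   node (graft t u) (troot (graft t u)) +` (profile t `+` profile u))%mset.
Proof.
apply/msetP => p; rewrite !mset1DE msetE2 !profile_sum big_sumType !addnA.
congr (_ + _)%N; last first.
  apply: eq_bigr => v _; congr (nat_of_bool (_ == p)).
  by rewrite /node fertility_graft_inr mk_deco.
rewrite (bigD1 (troot t)) // [in RHS](bigD1 (troot t)) //= addnCA.
rewrite ![p == _]eq_sym; do 2!congr (_ + _)%N.
apply: eq_bigr => v /negPf vr; congr (nat_of_bool (_ == p)).
by rewrite /node fertility_graft_inl mk_deco vr addn0.
Qed.

Lemma graft_inj t u t' u' :
  graft t u = graft t' u' -> troot u = troot u' -> t = t' /\ u = u'.
Proof.
move=> eq_g eq_r2.
have eq_r1 : troot t = troot t' by have [] := congr1 (@troot A _) eq_g.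
have eq_p x : graft_parent t u x = graft_parent t' u' x.
  by have := congr1 (fun s => parent s x) eq_g; rewrite !mk_parent.
have eq_d x : graft_deco t u x = graft_deco t' u' x.
  by have := congr1 (fun s => deco s x) eq_g; rewrite !mk_deco.
split; apply: dtree_eq => // v; try exact: (eq_d (inl v)); try exact: (eq_d (inr v)).
  by have [] := eq_p (inl v).
have := eq_p (inr v); rewrite /= -eq_r2.
(* Grafting overwrites the parent of the root of [u]; that value is recovered from the convention
   that a root is its own parent. *)
by have [-> _|_ []//] := eqVneq v (troot u); rewrite {2}eq_r2 !parent_root.
Qed.

(** Since the right summand is exactly the set of descendants of [c], the parent map preserves the
    left summand, and preserves the right one except at [c]. Both restrictions are therefore
    trees. *)
Lemma graft_surj (t : dtree A (V1 + V2)%type) c :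
  c \in children t (troot t) -> descendants t c = right_part ->
  exists2 y, t = graft y.1 y.2 & c = inr (troot y.2).
Proof.
rewrite inE => /andP[c_root /eqP pc] /setP desc.
have descE x : fconnect (parent t) x c = (if x is inr _ then true else false).
  by have := desc x; rewrite !inE.
case: c => [c|c] in c_root pc desc descE *.
  by have := descE (inl c); rewrite connect0.
(* A root on the right would descend from [c]; being fixed by the parent map, it would equal [c],
   which is a child. *)
case root_t : (troot t) => [r|r]; last first.
  have /iter_findex : fconnect (parent t) (troot t) (inr c) by rewrite root_t descE.
  have -> n : iter n (parent t) (troot t) = troot t.
    by elim: n => //= n ->; exact: parent_root.
  by move=> rc; rewrite -rc eqxx in c_root.
(* The default [r] of [p1] is never reached. The default [c] of [p2] is reached exactly at [c],
   which makes [c] the root of the right piece. *)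
pose p1 v := if parent t (inl v) is inl u then u else r.
pose p2 v := if parent t (inr v) is inr u then u else c.
have p1E v : parent t (inl v) = inl (p1 v).
  rewrite /p1; case E: (parent t (inl v)) => [//|u].
  have := descE (inl v); rewrite (connect_trans (fconnect1 _ _)) //.
  by rewrite /= E descE.
(* A vertex [v != c] on the right reaches [c] through its parent, so that parent is itself a
   descendant of [c]. *)
have p2E v : v != c -> parent t (inr v) = inr (p2 v).
  rewrite /p2 => vc; case E: (parent t (inr v)) => [u|//].
  have /iter_findex := descE (inr v); move: (findex _ _ _) => [|n].
    by case=> /eqP; rewrite (negPf vc).
  rewrite iterSr E => un; have := descE (inl u).
  by rewrite -un fconnect_iter.
have r1 : p1 r = r by rewrite /p1 -root_t parent_root root_t.
have r2 : p2 c = c by rewrite /p2 pc root_t.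
have c1 v : fconnect p1 v r.
  rewrite -(@fconnect_transfer _ _ inl p1 (parent t)) //; first last.
    by move=> x y [].
  by rewrite -root_t fconnect_root.
have c2 v : fconnect p2 v c.
  by rewrite -(@fconnect_transfer _ _ inr p2 (parent t)) ?descE // => x y [].
exists (mk_dtree (fun v => deco t (inl v)) r1 c1,
        mk_dtree (fun v => deco t (inr v)) r2 c2) => //=.
apply: dtree_eq => [//|v|v]; rewrite ?mk_parent ?mk_deco.
  case: v => v /=; first by rewrite p1E mk_parent.
  have [->|/p2E ->] := eqVneq v c; first by rewrite pc.
  by rewrite mk_parent.
by case: v => v /=; rewrite mk_deco.
Qed.
End Graft.

(** * Counting trees with a marked child of the root *)

Lemma sum_pred1_seq (T : eqType) (s : seq T) (P : pred T) x :
  uniq s -> x \in s -> (\sum_(y <- s) (P y && (x == y)) = P x)%N.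
Proof.
move=> us xs; rewrite (bigD1_seq x) //= eqxx andbT big1 ?addn0 // => y yx.
by rewrite eq_sym (negPf yx) andbF.
Qed.

(** Each multi-index below [k] comes from a subsequence of the enumeration of [k], hence from one of
    finitely many bit masks. *)
Lemma finite_submsets (k : mindex A) :
  finite_set [set l : mindex A | (l `<=` k)%mset]%classic.
Proof.
pose F (m : (size (enum_mset k)).-tuple bool) : mindex A :=
  seq_mset (mask m (enum_mset k)).
apply: (@sub_finite_set _ _ (F @` [set: _])%classic); last first.
  exact/finite_image/finite_finset.
move=> l /= /msubsetP lk.
have /count_subseqP[s /subseqP[m sm ->] ls] :
    forall x, (count_mem x (enum_mset l) <= count_mem x (enum_mset k))%N.
  by move=> x; rewrite !count_mem_mset.
exists (tcast sm (in_tuple m)) => //; rewrite /F val_tcast /=.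
by apply/msetP => x; rewrite mset_seqE -(seq.permP ls) count_mem_mset.
Qed.

Definition submsets (k : mindex A) : {fset mindex A} :=
  fset_set [set l : mindex A | (l `<=` k)%mset]%classic.

Lemma mem_submsets (k l : mindex A) : (l \in submsets k) = (l `<=` k)%mset.
Proof. by rewrite in_fset_set ?mem_setE //; exact: finite_submsets. Qed.

(* [k] lists the vertices of [t] other than the root. *)
Definition root_spec (V : finType) (t : dtree A V) (a : A) (i : nat)
    (k : mindex A) : bool :=
  [&& deco t (troot t) == a, fertility t (troot t) == i
    & profile t == ((a, arity_index i) +` k)%mset].

Definition nrooted (V : finType) (a : A) (i : nat) (k : mindex A) : nat :=
  #|[set t : dtree A V | root_spec t a i k]|.

Definition cuts (V : finType) (a : A) (i : nat) (k : mindex A) (S : {set V}) :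
    {set dtree A V * V} :=
  [set x | [&& root_spec x.1 a i k, x.2 \in children x.1 (troot x.1)
             & descendants x.1 x.2 == S]].

(** Double counting of pairs of a tree and a child of its root: by the descendant set of the child,
    or by the tree, whose root has [i] children. *)
Lemma sum_card_cuts (V : finType) a i k :
  (\sum_(S : {set V}) #|cuts a i k S| = i * nrooted V a i k)%N.
Proof.
pose P (x : dtree A V * V) :=
  root_spec x.1 a i k && (x.2 \in children x.1 (troot x.1)).
transitivity (\sum_(x | P x) 1)%N.
  rewrite [RHS](partition_big (fun x => descendants x.1 x.2) xpredT) //=.
  apply: eq_bigr => S _; rewrite -sum1_card; apply: eq_bigl => x.
  by rewrite inE /P andbA.
rewrite -(pair_big_dep (fun t => root_spec t a i k)
  (fun t c => c \in children t (troot t)) (fun _ _ => 1%N)) /=.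
rewrite mulnC /nrooted -sum_nat_const; apply: eq_big => [t|t]; first by rewrite inE.
by rewrite sum1_card => /and3P[_ /eqP].
Qed.

Lemma descendants_relabel (V V' : finType) (h : V -> V') (g : V' -> V)
    (hK : cancel h g) (gK : cancel g h) (t : dtree A V) c :
  descendants (relabel hK gK t) (h c) = h @: descendants t c.
Proof.
apply/setP => w; rewrite -(gK w) mem_imset ?inE; last exact: can_inj hK.
rewrite (@fconnect_transfer _ _ h (parent t)) //; first exact: can_inj hK.
by move=> x _; rewrite mk_parent hK.
Qed.

Lemma root_spec_relabel (V V' : finType) (h : V -> V') (g : V' -> V)
    (hK : cancel h g) (gK : cancel g h) (t : dtree A V) a i k :
  root_spec (relabel hK gK t) a i k = root_spec t a i k.
Proof.
by rewrite /root_spec profile_relabel mk_root fertility_relabel mk_deco hK.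
Qed.

(** Relabelling injects cuts into cuts; the inverse relabelling will supply the opposite
    inequality. *)
Lemma leq_card_cuts (V V' : finType) (h : V -> V') (g : V' -> V)
    (hK : cancel h g) (gK : cancel g h) a i k (S : {set V}) :
  (#|cuts a i k S| <= #|cuts a i k (h @: S)|)%N.
Proof.
pose f (x : dtree A V * V) := (relabel hK gK x.1, h x.2).
have f_inj : injective f.
  move=> [t c] [t' c'] eq_f; congr (_, _).
    exact: can_inj (relabelK hK gK) _ _ (congr1 fst eq_f).
  exact: can_inj hK _ _ (congr1 snd eq_f).
rewrite -(card_imset _ f_inj); apply: subset_leq_card.
apply/fintype.subsetP => _ /imsetP[[t c] + ->]; rewrite inE /=.
case/and3P => tP tc /eqP <-.
rewrite inE /= root_spec_relabel tP descendants_relabel eqxx andbT /=.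
by rewrite mk_root children_relabel mem_imset //; exact: can_inj hK.
Qed.

Lemma card_cuts_imset (V V' : finType) (h : V -> V') a i k (S : {set V}) :
  bijective h -> #|cuts a i k (h @: S)| = #|cuts a i k S|.
Proof.
case=> g hK gK; apply/eqP; rewrite eqn_leq (leq_card_cuts hK gK) andbT.
apply: leq_trans (leq_card_cuts gK hK a i k (h @: S)) _.
by rewrite -imset_comp (eq_imset _ hK) imset_id.
Qed.

(** Grafting is a bijection from pairs of trees onto the cuts at the right summand. It gives the
    root one more child, hence the drop from [i.+1] to [i]. *)
Lemma card_cuts_right (V1 V2 : finType) a i k :
  #|cuts a i.+1 k (right_part V1 V2)| =
  #|[set y : dtree A V1 * dtree A V2 |
      [&& deco y.1 (troot y.1) == a, fertility y.1 (troot y.1) == i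
        & (profile y.1 `+` profile y.2 == (a, arity_index i) +` k)%mset]]|.
Proof.
pose f (y : dtree A V1 * dtree A V2) :=
  (graft y.1 y.2, inr (troot y.2) : (V1 + V2)%type).
have f_inj : injective f.
  move=> [t u] [t' u'] eq_f; have [eq_r] := congr1 snd eq_f.
  by have [/= -> ->] := graft_inj (congr1 fst eq_f) eq_r.
have spec (t : dtree A V1) (u : dtree A V2) : root_spec (graft t u) a i.+1 k =
    [&& deco t (troot t) == a, fertility t (troot t) == i
      & (profile t `+` profile u == (a, arity_index i) +` k)%mset].
  rewrite /root_spec mk_deco fertility_graft_inl eqxx addn1 eqSS /=.
  apply: andb_id2l => /eqP ta; apply: andb_id2l => /eqP ti.
  have := profile_graft t u.
  rewrite /node mk_deco fertility_graft_inl eqxx addn1 /= ta ti => eq_p.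
  (* Adding the old root node to both sides makes the profile identity for grafts applicable; the
     new root node then cancels. *)
  rewrite -(can_eq (msetDKB [mset (a, arity_index i)]%mset)) eq_p.
  by rewrite (msetDCA [mset (a, arity_index i)]%mset) (can_eq (msetDKB _)).
rewrite -(card_imset _ f_inj); apply: eq_card => -[s c].
apply/idP/imsetP => [|[[t u] tu [-> ->]]].
  rewrite inE /= => /and3P[ss sc /eqP sr].
  have [[t u] /= eq_s eq_c] := graft_surj sc sr.
  by exists (t, u); rewrite ?eq_s ?eq_c // inE /= -spec -eq_s.
move: tu; rewrite inE /= -spec => tu.
by rewrite inE /= tu graft_child graft_descendants eqxx.
Qed.

(** A bijection moves [S] to the right summand of a disjoint union; the resulting pairs are then
    sorted by the profile [l] of the subtree cut off. *)
Lemma card_cuts_pairs (V : finType) a i k (S : {set V}) :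
  #|cuts a i.+1 k S| =
  (\sum_(l <- submsets k)
     nrooted 'I_#|~: S| a i (k `\` l)%mset * ntrees 'I_#|S| l)%N.
Proof.
pose h (x : 'I_#|~: S| + 'I_#|S|) :=
  match x with inl v => enum_val v | inr v => enum_val v end.
have h_inj : injective h.
  move=> [x|x] [y|y] /= hxy; try by rewrite (enum_val_inj hxy).
    by have := enum_valP x; rewrite hxy inE enum_valP.
  by have := enum_valP y; rewrite -hxy inE enum_valP.
have h_bij : bijective h.
  by apply: inj_card_bij => //; rewrite card_sum !card_ord addnC cardsC.
have hS : h @: right_part 'I_#|~: S| 'I_#|S| = S.
  apply/setP => v; apply/imsetP/idP => [[[x|x] /[!inE] // _ ->]|vS].
    exact: enum_valP.
  by exists (inr (enum_rank_in vS v)); rewrite ?inE //= enum_rankK_in.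
rewrite -{1}hS card_cuts_imset // card_cuts_right.
(* For a fixed pair, only [l = profile y.2] can contribute. *)
transitivity (\sum_(l <- submsets k)
    \sum_(y : dtree A 'I_#|~: S| * dtree A 'I_#|S|)
      (root_spec y.1 a i (k `\` l)%mset && (profile y.2 == l)))%N; last first.
  apply: eq_bigr => l _; rewrite /nrooted /ntrees -cardsX -[RHS]sum1_card.
  rewrite [RHS]big_mkcond /=; apply: eq_bigr => y _.
  by rewrite !inE; case: (_ && _).
rewrite exchange_big -[LHS]sum1_card [LHS]big_mkcond /=; apply: eq_bigr => -[t u] _.
rewrite inE /root_spec /=; have [ta|_] := eqVneq; last by rewrite big1.
have [ti|_] := eqVneq; last by rewrite big1.
rewrite /=; set e : A * geN1 := (a, _).
(* The root node [e] occurs in [profile t], so equality of the total profiles forces [profile u] to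
   lie below [k]. Summing over [submsets k] thus misses no pair. *)
have et : ([mset e] `<=` profile t)%mset.
  rewrite msub1set -mset_gt0 profile_sum (bigD1 (troot t)) //.
  by rewrite /node ta ti eqxx.
move: (profile t) (profile u) et => q r et.
have [uk|uk] := boolP (r `<=` k)%mset; last first.
  rewrite big_seq big1 => [|l]; last first.
    rewrite mem_submsets => lk; case: (r =P l) => [ul|_].
      by rewrite ul lk in uk.
    by rewrite andbF.
  case: eqP => // eq_p; case/negP: uk; apply/msubsetP => p.
  move/msubsetP: et => /(_ p); move/msetP/(_ p): eq_p.
  rewrite !msetE2; lia.
have -> : (q `+` r == e +` k)%mset = (q == (e +` (k `\` r)))%mset.
  by rewrite -(can_eq (msetDKBC r) q) -msetDA msetBDK.
rewrite (sum_pred1_seq (fun l => q == (e +` (k `\` l))%mset)).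
- by case: ifP.
- exact: fset_uniq.
- by rewrite mem_submsets.
Qed.

Lemma nrootedS (V : finType) a i k :
  (i.+1 * nrooted V a i.+1 k =
   \sum_(l <- submsets k) \sum_(S : {set V})
     nrooted 'I_#|~: S| a i (k `\` l)%mset * ntrees 'I_#|S| l)%N.
Proof.
rewrite -sum_card_cuts exchange_big; apply: eq_bigr => S _.
exact: card_cuts_pairs.
Qed.

(** * Counting by profile *)

Lemma leq_ntrees (V V' : finType) k :
  #|V| = #|V'| -> (ntrees V k <= ntrees V' k)%N.
Proof.
move=> eVV'; pose h (v : V) : V' := enum_val (cast_ord eVV' (enum_rank v)).
pose g (v : V') : V := enum_val (cast_ord (esym eVV') (enum_rank v)).
have hK : cancel h g by move=> v; rewrite /g /h enum_valK cast_ordK enum_rankK.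
have gK : cancel g h by move=> v; rewrite /g /h enum_valK cast_ordKV enum_rankK.
rewrite /ntrees -(card_imset _ (can_inj (relabelK hK gK))).
apply: subset_leq_card; apply/fintype.subsetP => _ /imsetP[t + ->].
by rewrite !inE profile_relabel.
Qed.

(** The count depends on [V] only through its cardinality, and a profile determines the number of
    vertices. *)
Lemma ntreesE (V : finType) (k : mindex A) :
  (ntrees V k)%:R = (if #|V| == msize k then (#|V|)`!%:R * W k else 0) :> rat.
Proof.
case: eqP => [cardV|cardV].
  have -> : ntrees V k = ntrees 'I_(msize k) k.
    by apply/eqP; rewrite eqn_leq !leq_ntrees // card_ord.
  by rewrite W_ntrees cardV mulrC divfK // pnatr_eq0 -lt0n fact_gt0.
apply/eqP; rewrite pnatr_eq0 cards_eq0; apply/eqP/setP => t; rewrite !inE.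
by apply/negP => /eqP tk; apply: cardV; rewrite -tk card_profile.
Qed.

(** * Size and weight of multi-indices *)

Lemma perm_enum_msetD (k l : mindex A) :
  perm_eq (enum_mset (k `+` l)%mset) (enum_mset k ++ enum_mset l).
Proof.
by apply/allP => x _; apply/eqP; rewrite count_cat !count_mem_mset msetE2.
Qed.

Lemma msizeD (k l : mindex A) : msize (k `+` l)%mset = (msize k + msize l)%N.
Proof. by rewrite !msizeE (perm_size (perm_enum_msetD k l)) size_cat. Qed.

Lemma msizeB (k l : mindex A) :
  (l `<=` k)%mset -> msize (k `\` l)%mset = (msize k - msize l)%N.
Proof. by move=> lk; rewrite -{2}(msetBDK lk) msizeD addnK. Qed.

Lemma msize_mset1 (p : A * geN1) : msize [mset p]%mset = 1%N.
Proof. by rewrite msizeE enum_msetn. Qed.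

Lemma wt_enum (k : mindex A) : wt k = \sum_(p <- enum_mset k) val p.2.
Proof.
rewrite big_mset /=; apply: eq_bigr => p _.
by rewrite Monoid.iteropE iter_addr_0 pmulrn -mulrzz.
Qed.

(** Every vertex except the root is counted once, at its parent. *)
Lemma sum_fertility (V : finType) (t : dtree A V) :
  (\sum_v fertility t v = #|V|.-1)%N.
Proof.
under eq_bigr do rewrite fertility_sum.
rewrite exchange_big -(cardC1 (troot t)) -sum1_card [RHS]big_mkcond /=.
apply: eq_bigr => u _; rewrite (bigD1 (parent t u)) //= eqxx andbT big1 ?addn0.
  by rewrite !inE; case: eqP.
by move=> v; rewrite eq_sym => /negPf ->; rewrite andbF.
Qed.

(** The weight sums fertility minus one over all vertices, giving [(#|V| - 1) - #|V|]. *)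
Lemma wt_profile (V : finType) (t : dtree A V) : wt (profile t) = -1.
Proof.
rewrite wt_enum (perm_big _ (perm_eq_seq_mset _)) big_map big_enum /=.
rewrite sumrB sumr_const natz -(big_morph Posz PoszD erefl) sum_fertility.
have : (0 < #|V|)%N by apply/card_gt0P; exists (troot t).
by case: #|V| => // n _; rewrite intS opprD addrCA /= subrr addr0.
Qed.

Lemma W_wt (k : mindex A) : wt k != -1 -> W k = 0.
Proof.
move=> wtk; rewrite W_ntrees [ntrees _ _](_ : _ = 0%N) ?mul0r //.
apply/eqP; rewrite cards_eq0; apply/eqP/setP => t; rewrite !inE.
by apply: contraNF wtk => /eqP <-; rewrite wt_profile.
Qed.

(** * Sums over ordered decompositions *)

Definition sumW (n : nat) (k : mindex A) : rat :=
  \sum_(ks \in decompositions k n) \prod_(m < n) W (ks m).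

Lemma sumW0 (k : mindex A) : sumW 0 k = (k == mset0)%:R.
Proof.
rewrite /sumW; have [->|k0] := eqVneq k mset0; last first.
  rewrite [decompositions _ _](_ : _ = set0) ?fsbig_set0 //.
  by apply/seteqP; split=> // ks []; rewrite big_ord0 => /esym/eqP; rewrite (negPf k0).
pose ks0 : {ffun 'I_0 -> mindex A} := [ffun _ => mset0].
rewrite [decompositions _ _](_ : _ = [set ks0]%classic).
  by rewrite fsbig_set1 big_ord0.
apply/seteqP; split=> [ks _ | _ ->] /=; first by apply/ffunP => -[].
by split; [rewrite big_ord0 | case].
Qed.

Definition cons_ffun n (l : mindex A) (ks : {ffun 'I_n -> mindex A}) :
    {ffun 'I_n.+1 -> mindex A} :=
  [ffun m => if unlift ord0 m is Some m' then ks m' else l].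

Lemma cons_ffun0 n l (ks : {ffun 'I_n -> mindex A}) : cons_ffun l ks ord0 = l.
Proof. by rewrite ffunE unlift_none. Qed.

Lemma cons_ffunS n l (ks : {ffun 'I_n -> mindex A}) m :
  cons_ffun l ks (lift ord0 m) = ks m.
Proof. by rewrite ffunE liftK. Qed.

(** The first component is split off. It may range over all [l] below [k], because [W l] vanishes
    when the weight of [l] is not [-1]. *)
Lemma sumWS n (k : mindex A) :
  sumW n.+1 k = \sum_(l <- submsets k) W l * sumW n (k `\` l)%mset.
Proof.
pose F (ks : {ffun 'I_n.+1 -> mindex A}) := \prod_(m < n.+1) W (ks m).
have headP ks : decompositions k n.+1 ks -> ks ord0 \in submsets k.
  by move=> [<- _]; rewrite mem_submsets big_ord_recl; apply/msubsetP => x;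
     rewrite msetE2 leq_addr.
(* The inner sum has a single nonzero candidate, the head of [ks]; inserting it permits an exchange
   of summations. *)
transitivity (\sum_(ks \in decompositions k n.+1)
   \sum_(l <- submsets k) (if ks ord0 == l then F ks else 0)).
  apply: eq_fsbigr => ks; rewrite inE => /headP ksk.
  rewrite -big_mkcond /= (eq_bigl (pred1 (ks ord0))) => [|l].
    by rewrite -[RHS]big_filter filter_pred1_uniq ?fset_uniq // big_seq1.
  by rewrite eq_sym.
rewrite fsbig_finite; last exact: finite_decompositions.
rewrite exchange_big /= big_seq [RHS]big_seq; apply: eq_bigr => l.
rewrite mem_submsets => lk; rewrite -fsbig_finite; last exact: finite_decompositions.
have [wtl|wtl] := eqVneq (wt l) (-1); last first.
  rewrite (W_wt wtl) mul0r fsbig1 // => ks [_ wtks]; case: eqP => // ksl.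
  by rewrite -ksl wtks in wtl.
rewrite /sumW mulr_fsumr.
transitivity (\sum_(ks \in decompositions k n.+1 `&` [set ks | ks ord0 = l])
    F ks)%classic.
  rewrite [RHS]fsbig_mkcondr; apply: eq_fsbigr => ks _.
  by case: eqP => ksl; [rewrite ifT // inE | rewrite ifF //; apply/negP; rewrite inE].
(* For [l] of weight [-1], prepending [l] is a bijection onto the decompositions of [k] with head
   [l]. *)
rewrite (reindex_fsbig (@cons_ffun n l) (decompositions (k `\` l)%mset n)).
  apply: eq_fsbigr => ks _; rewrite /F big_ord_recl cons_ffun0; congr (_ * _).
  by apply: eq_bigr => m _; rewrite cons_ffunS.
have sumcons ks : (\big[msetD/mset0]_(m < n.+1) cons_ffun l ks m =
                  l `+` \big[msetD/mset0]_(m < n) ks m)%mset.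
  rewrite big_ord_recl cons_ffun0; congr msetD.
  by apply: eq_bigr => m _; rewrite cons_ffunS.
split=> [ks [sks wtks] | ks ks' _ _ eq_ks | ks [[sks wtks] ksl]].
- split; last exact: cons_ffun0.
  split=> [|m]; first by rewrite sumcons sks msetBDKC.
  by rewrite ffunE; case: unliftP => [m' _|_]; rewrite ?wtks.
- by apply/ffunP => m; rewrite -(cons_ffunS l ks) eq_ks cons_ffunS.
have ksE : cons_ffun l [ffun m => ks (lift ord0 m)] = ks.
  by apply/ffunP => m; rewrite ffunE; case: unliftP => [m' ->|->]; rewrite ?ffunE.
exists [ffun m => ks (lift ord0 m)] => //; split=> [|m]; last by rewrite ffunE.
by rewrite -sks -ksE sumcons msetDKB ksE.
Qed.

(** * Solving the recursion on the root fertility *)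

(** A path from another vertex would have to enter the root through a child. *)
Lemma fertility_root0 (V : finType) (t : dtree A V) :
  fertility t (troot t) = 0%N -> forall v, v = troot t.
Proof.
move/eqP; rewrite cards_eq0 => /eqP c0 v.
have /iter_findex := fconnect_root t v; move: (findex _ _ _) => n.
elim: n v => [//|n IHn] v; rewrite iterSr => /IHn pv; apply/eqP/negPn/negP => vr.
by have := finset.in_set0 v; rewrite -c0 inE vr pv eqxx.
Qed.

Lemma nrooted0 (V : finType) a (k : mindex A) :
  #|V| = (msize k).+1 -> nrooted V a 0 k = (k == mset0).
Proof.
move=> cardV; have [k0|k0] := eqVneq k mset0; last first.
  apply/eqP; rewrite cards_eq0; apply/eqP/setP => t; rewrite !inE.
  apply/negP => /and3P[_ /eqP/fertility_root0 tr _]; case/negP: k0.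
  have : (#|V| <= 1)%N by apply/fintype_le1P => v w; rewrite (tr v) (tr w).
  rewrite cardV ltnS leqn0 msizeE size_eq0 => /eqP ks.
  by apply/eqP/msetP => p; rewrite -count_mem_mset ks mset0E.
have card1 : #|V| = 1%N by rewrite cardV k0 msizeE enum_mset0.
have [v0 v0P] := fintype1 card1.
pose t0 : dtree A V := @mk_dtree V v0 id (fun=> a) erefl
  (fun v => eq_ind_r (fun v => fconnect id v v0) (connect0 _ v0) (v0P v)).
have fert (t : dtree A V) : fertility t v0 = 0%N.
  by rewrite fertility_sum big1 // => u _; rewrite (v0P u) (v0P (troot t)) eqxx.
rewrite /nrooted [X in #|pred_of_set X|](_ : _ = [set t0]) ?cards1 //.
apply/setP => t; rewrite !inE /root_spec; apply/idP/eqP => [|->].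
  case/and3P => /eqP ta _ _; apply: dtree_eq => [|v|v].
  - by rewrite (v0P (troot t)).
  - by rewrite (v0P (parent t v)) (v0P (parent t0 v)).
  - by rewrite mk_deco -ta (v0P v) (v0P (troot t)).
rewrite mk_deco mk_root fert !eqxx /=; apply/eqP/msetP => p.
rewrite profile_sum (bigD1 v0) //= big1 ?addn0.
  by rewrite k0 msetD0 /node mk_deco fert msetnE eq_sym; case: eqP.
by move=> v; rewrite (v0P v) eqxx.
Qed.

(** Induction on [i]. With [n = #|V|] and [m = msize l], there are ['C(n, m)] choices of [S], and
    ['C(n, m) * m! * (n - m)! = n!]; the factor [i.+1] from the choice of the cut child turns [i!]
    into [(i.+1)!]. *)
Lemma nrootedE (V : finType) a i (k : mindex A) :
  #|V| = (msize k).+1 ->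
  (nrooted V a i k)%:R = (#|V|)`!%:R / i`!%:R * sumW i k :> rat.
Proof.
elim: i V k => [|i IHi] V k cardV.
  rewrite nrooted0 // sumW0; have [k0|_] := eqVneq k mset0; last by rewrite mulr0.
  by rewrite cardV k0 msizeE enum_mset0 divr1 mulr1.
have i1 : i.+1%:R != 0 :> rat by rewrite pnatr_eq0.
have -> : (#|V|)`!%:R / (i.+1)`!%:R * sumW i.+1 k =
    (#|V|)`!%:R / i`!%:R * sumW i.+1 k / i.+1%:R.
  by rewrite factS natrM invfM; move: (i.+1%:R^-1) (i`!%:R^-1) => x y; ring.
apply: (mulfI i1); rewrite -natrM nrootedS natr_sum mulrC divfK // sumWS.
rewrite mulr_sumr big_seq [RHS]big_seq.
apply: eq_bigr => l; rewrite mem_submsets => lk; rewrite natr_sum.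
have mlk : (msize l <= msize k)%N.
  by rewrite -[in X in (_ <= X)%N](msetBDK lk) msizeD leq_addl.
pose c : rat := (#|V| - msize l)`!%:R / i`!%:R * sumW i (k `\` l)%mset *
  ((msize l)`!%:R * W l).
(* Only sets of size [msize l] carry a tree of profile [l], and each of them contributes the same
   amount [c]. *)
transitivity (\sum_(S : {set V} | #|S| == msize l) c).
  rewrite [RHS]big_mkcond; apply: eq_bigr => S _; rewrite natrM ntreesE card_ord.
  case: eqP => [cS|_]; last by rewrite mulr0.
  have cSC : #|~: S| = (#|V| - msize l)%N by rewrite -cS -(cardsC S) addKn.
  rewrite IHi card_ord ?cSC ?cS // msizeB // cardV; lia.
rewrite sumr_const -mulr_natl.
have -> : #|[pred S : {set V} | #|S| == msize l]| = 'C(#|V|, msize l).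
  by rewrite -card_draws; apply: eq_card => S; rewrite !inE.
have leV : (msize l <= #|V|)%N by rewrite cardV leqW.
rewrite -(bin_fact leV) !natrM /c.
ring.
Qed.

(** * Sorting trees by their root node, and the final recursion *)

Lemma finite_arities (k : mindex A) a :
  finite_set [set j : geN1 | (1 <= k (a, j))%N]%classic.
Proof.
apply: (@sub_finite_set _ _ (snd @` [set` finsupp k])%classic); last first.
  exact/finite_image/finite_fset.
by move=> j kj; exists (a, j) => //=; rewrite msuppE -mset_gt0.
Qed.

(** Each tree of profile [k] has exactly one root node [(a, j)]. This node occurs in [k], so
    removing it leaves the profile of the other vertices. *)
Lemma ntrees_root (V : finType) (k : mindex A) :
  ntrees V k = (\sum_a \sum_(j <- fset_set [set j | (1 <= k (a, j))%N]%classic)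
    nrooted V a (arity j) (k `\` [mset (a, j)])%mset)%N.
Proof.
pose J a := fset_set [set j : geN1 | (1 <= k (a, j))%N]%classic.
have memJ a j : (j \in J a) = ((a, j) \in k).
  rewrite in_fset_set; last exact: finite_arities.
  by rewrite mem_setE -mset_gt0.
transitivity (\sum_a \sum_(j <- J a) \sum_(t : dtree A V)
    (((profile t == k) && (deco t (troot t) == a)) &&
       (arity_index (fertility t (troot t)) == j)))%N; last first.
  apply: eq_bigr => a _; rewrite big_seq [RHS]big_seq; apply: eq_bigr => j.
  rewrite memJ => kj; rewrite /nrooted -[RHS]sum1_card [RHS]big_mkcond /=.
  apply: eq_bigr => t _; rewrite inE /root_spec arityK msetB1K //.
  rewrite -(can_eq arityK) arity_indexK.
  by case: (profile t == k); case: (deco _ _ == a); case: (_ == arity j).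
under eq_bigr do rewrite exchange_big.
rewrite exchange_big /ntrees -sum1_card big_mkcond /=; apply: eq_bigr => t _.
rewrite inE; have [tk|_] := boolP (profile t == k); last first.
  by rewrite big1 // => a _; rewrite big1.
rewrite (bigD1 (deco t (troot t))) //= [X in (_ + X)%N]big1 ?addn0 => [|a].
  rewrite (sum_pred1_seq (fun=> deco t (troot t) == deco t (troot t))) ?eqxx //.
    exact: fset_uniq.
  rewrite memJ -(eqP tk) -mset_gt0 profile_sum (bigD1 (troot t)) //.
  by rewrite /node eqxx.
by rewrite eq_sym => /negPf ta; rewrite big1 // => j _; rewrite ta.
Qed.
End Trees.

Theorem proposition3p7 (A : finType) (k : mindex A) (hk : wt k = -1) :
  W k =
  \sum_(a : A) \sum_(j \in [set j : geN1 | (1 <= k (a, j))%N]%classic)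
    ((arity j)`!%:R)^-1 *
    \sum_(ks \in decompositions (k `\` [mset (a, j)])%mset (arity j))
      \prod_(m < arity j) W (ks m).
Proof.
rewrite W_ntrees ntrees_root natr_sum mulr_suml; apply: eq_bigr => a _.
rewrite fsbig_finite; last exact: finite_arities.
rewrite natr_sum mulr_suml big_seq [RHS]big_seq; apply: eq_bigr => j.
rewrite in_fset_set; last exact: finite_arities.
rewrite inE /= => kj.
(* The root accounts for one vertex, so [nrootedE] applies on ['I_(msize k)]; its factor
   [(msize k)!] cancels the denominator from [W_ntrees]. *)
have msz : msize k = (msize (k `\` [mset (a, j)])%mset).+1.
  by rewrite -{1}(@msetB1K _ (a, j) k) -?mset_gt0 // msizeD msize_mset1.
rewrite nrootedE card_ord //.
by rewrite mulrC -!mulrA mulKf // pnatr_eq0 -lt0n fact_gt0.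
Qed.
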